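(* Let $\mathcal{H}$ be a Hilbert space, let $\ell\ge1$, let $i\mapsto i^*$ be an involution of $\{1,\ldots,\ell\}$, and let $b_1,\ldots,b_\ell\in\mathcal{B}(\mathcal{H})$. Define on $\mathcal{H}\otimes\mathbb{C}^\ell$ $$B=\sum_{(i,j):\,j\ne i^*}b_j\otimes E_{ij},\qquad\widetilde B=\sum_{(i,j):\,j\ne i^*}b_i\otimes E_{ij}.$$ Let $\lambda\in\mathbb{C}$ satisfy $\lambda^2\notin\sigma(b_ib_{i^*})$ for all $i\in\{1,\ldots,\ell\}$. Define the operator $A^{(\lambda)}$ on $\mathcal{H}$ by $$A^{(\lambda)}=b_0(\lambda)+\sum_{i=1}^\ell b_i(\lambda),\qquad b_i(\lambda)=\lambda b_i(\lambda^2-b_{i^*}b_i)^{-1},\qquad b_0(\lambda)=-1-\sum_{i=1}^\ell b_i(\lambda^2-b_{i^*}b_i)^{-1}b_{i^*}.$$ Then $\lambda\in\sigma(B)$ if and only if $0\in\sigma(A^{(\lambda)})$. Similarly, $\lambda\in\sigma(\widetilde B)$ if and only if $0\in\sigma(A^{(\lambda)})$.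
   Context: $\mathcal{B}(\mathcal{H})$ is the algebra of bounded operators on $\mathcal{H}$, $\sigma(\cdot)$ denotes the spectrum, $E_{ij}\in M_\ell(\mathbb{R})$ are the canonical matrix units, $1$ is the identity operator, and scalars are identified with multiples of the identity. *)

(* Defs.v *)
From HB Require Import structures.
From mathcomp Require Import all_boot all_order all_algebra.
From mathcomp Require Import complex.
From mathcomp Require Import all_classical all_reals all_analysis.

Set Implicit Arguments.
Unset Strict Implicit.
Unset Printing Implicit Defensive.
Import Order.TTheory GRing.Theory Num.Theory.
Import numFieldNormedType.Exports.

Local Open Scope classical_set_scope.
Local Open Scope ring_scope.

(* The library's CauchySchwarz and triangle_lerif are restricted to
   finite-dimensional spaces. *)
Section DotNorm.
Variables (C : numClosedFieldType) (U : lmodType C).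
Variable form : {dot U for @Num.conj C}.

Lemma dot_CauchySchwarz (u v : U) :
  `|form u v| ^+ 2 <= form u u * form v v.
Proof.
have [->|nz_v] := eqVneq v 0.
  by rewrite !linear0r normr0 expr0n.
pose a := form u v / form v v; pose u1 := u - a *: v.
have ou : form u1 v = 0.
  by rewrite linearBl /= linearZl_LR divfK ?dnorm_eq0 ?subrr.
have -> : u = u1 + a *: v by rewrite subrK.
rewrite linearDl /= ou add0r linearZl_LR /= normrM (ger0_norm (dnorm_ge0 _ _)).
rewrite exprMn expr2 mulrA; apply: ler_wpM2r; first exact: dnorm_ge0.
rewrite hnormDd /=; last by rewrite linearZr_LR /= ou mulr0.
by rewrite dnormZ lerDr dnorm_ge0.
Qed.

Lemma dot_triangle (u v : U) :
  sqrtC (form (u + v) (u + v)) <= sqrtC (form u u) + sqrtC (form v v).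
Proof.
have su : 0 <= sqrtC (form u u) by rewrite sqrtC_ge0 dnorm_ge0.
have sv : 0 <= sqrtC (form v v) by rewrite sqrtC_ge0 dnorm_ge0.
rewrite -ler_sqr ?nnegrE ?addr_ge0 ?sqrtC_ge0 ?dnorm_ge0//.
rewrite sqrrD !sqrtCK addrAC dnormD lerD2l.
have CS : `|form u v| <= sqrtC (form u u) * sqrtC (form v v).
  rewrite -ler_sqr ?nnegrE ?mulr_ge0// exprMn !sqrtCK.
  exact: dot_CauchySchwarz.
have -> : form u v + (form u v)^* = 'Re (form u v) *+ 2.
  by rewrite ReE -mulr_natr divfK ?pnatr_eq0.
by rewrite lerMn2r /= (le_trans _ CS)// (leif_Re_Creal _).1.
Qed.

End DotNorm.

HB.mixin Record CompleteNormedModule_isHilbert (R : realType) (H : Type)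
    of CompleteNormedModule R[i] H := {
  hdot : {dot H for @Num.conj R[i]} ;
  hdot_norm : forall x : H, `|x| ^+ 2 = hdot x x
}.

#[short(type="hilbertType")]
HB.structure Definition Hilbert (R : realType) :=
  {H of CompleteNormedModule R[i] H & CompleteNormedModule_isHilbert R H}.

(* H \otimes C^l, realised as the l-fold Hilbert direct sum of H; see [elemt]
   for the elementary tensors. *)
Definition tensC (R : realType) (H : hilbertType R) (l : nat) : Type :=
  {ffun 'I_l -> H}.

Section TensC.
Variables (R : realType) (H : hilbertType R) (l : nat).

HB.instance Definition _ := GRing.Lmodule.copy (tensC H l) {ffun 'I_l -> H}.

Definition tdot (x y : tensC H l) : R[i] := \sum_i hdot (x i) (y i).

Let tdot_bilinear : bilinear_for *%R (@Num.conj R[i] \; *%R) tdot.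
Proof.
split=> [y a u v|x a u v]; rewrite /tdot /= mulr_sumr -big_split /=;
  apply: eq_bigr => i _; rewrite !ffunE.
  by rewrite linearDl /= linearZl_LR.
by rewrite linearDr /= linearZr_LR.
Qed.

HB.instance Definition _ := @bilinear_isBilinear.Build R[i]
  (tensC H l) (tensC H l) R[i] *%R (@Num.conj R[i] \; *%R) tdot tdot_bilinear.

Let tdot_herm x y : tdot x y = (-1) ^+ false * (tdot y x)^*.
Proof.
rewrite expr0 mul1r /tdot rmorph_sum; apply: eq_bigr => i _.
by rewrite hermC /= expr0 mul1r.
Qed.

HB.instance Definition _ := @isHermitianSesquilinear.Build R[i]
  (tensC H l) false (@Num.conj R[i]) tdot tdot_herm.

Let tdot_gt0 x : x != 0 -> 0 < tdot x x.
Proof.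
move=> x0; rewrite lt_def sumr_ge0 ?andbT => [|i _]; last exact: dnorm_ge0.
apply: contra x0 => /eqP x0; apply/eqP/ffunP => i; rewrite ffunE.
apply/eqP; rewrite -(dnorm_eq0 (hdot (s := H))).
by move/psumr_eq0P : x0 => ->// j _; exact: dnorm_ge0.
Qed.

HB.instance Definition _ := @isDotProduct.Build R[i] (tensC H l) tdot tdot_gt0.

Let tnorm (x : tensC H l) : R[i] := sqrtC (tdot x x).

Let tnormD x y : tnorm (x + y) <= tnorm x + tnorm y.
Proof. exact: dot_triangle. Qed.

Let tnormZ (a : R[i]) x : tnorm (a *: x) = `|a| * tnorm x.
Proof. by rewrite /tnorm dnormZ sqrtCM ?nnegrE ?exprn_ge0 ?dnorm_ge0// sqrCK. Qed.

Let tnorm0_eq0 x : tnorm x = 0 -> x = 0.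
Proof. by move/eqP; rewrite sqrtC_eq0 dnorm_eq0 => /eqP. Qed.

HB.instance Definition _ := @Lmodule_isNormed.Build R[i] (tensC H l)
  tnorm tnormD tnormZ tnorm0_eq0.

Lemma tdot_norm (x : tensC H l) : `|x| ^+ 2 = tdot x x.
Proof. exact: sqrtCK. Qed.

Lemma tnorm_sqr (x : tensC H l) : `|x| ^+ 2 = \sum_i `|x i| ^+ 2.
Proof. by rewrite tdot_norm; apply: eq_bigr => i _; rewrite hdot_norm. Qed.

Lemma le_coord_tnorm (x : tensC H l) i : `|x i| <= `|x|.
Proof.
rewrite -ler_sqr ?nnegrE// tnorm_sqr (bigD1 i)//= lerDl.
by apply: sumr_ge0 => j _; rewrite exprn_ge0.
Qed.

Lemma tnorm_le_sum (x : tensC H l) : `|x| <= \sum_i `|x i|.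
Proof.
rewrite -ler_sqr ?nnegrE ?sumr_ge0// tnorm_sqr.
suff [] : 0 <= \sum_i `|x i| /\ \sum_i `|x i| ^+ 2 <= (\sum_i `|x i|) ^+ 2 by [].
elim/big_rec2: _ => [|i s t _ [t0 st]]; first by rewrite expr0n.
split; first by rewrite addr_ge0.
rewrite sqrrD addrAC -[leLHS]addr0 lerD//; last by rewrite mulrn_wge0// mulr_ge0.
by rewrite lerD2l.
Qed.

Let tensC_complete (F : set_system (tensC H l)) :
  ProperFilter F -> cauchy F -> cvg F.
Proof.
move=> FF /cauchy_ballP Fc.
have cvgi i : cvg ((fun x : tensC H l => x i) @ F).
  apply: cauchy_cvg; apply/cauchy_ballP => e e0.
  rewrite near_map2; apply: filterS (Fc e e0) => -[x y] /=.
  rewrite -!ball_normE /=; apply: le_lt_trans.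
  by have := le_coord_tnorm (x - y) i; rewrite !ffunE.
pose y : tensC H l := [ffun i => lim ((fun x : tensC H l => x i) @ F)].
apply/cvg_ex; exists y; apply/cvgrPdist_lt => e e0.
have d0 : 0 < e / l.+1%:R by rewrite divr_gt0.
have near_all : \forall x \near F, forall i, `|y i - (x : tensC H l) i| < e / l.+1%:R.
  apply: filter_forall => i; rewrite ffunE.
  by have /cvgrPdist_lt/(_ _ d0) := cvgi i.
near=> x; rewrite (le_lt_trans (tnorm_le_sum _))//.
have H1 : \sum_i `|(y - x) i| <= \sum_(i < l) e / l.+1%:R.
  apply: ler_sum => i _; rewrite !ffunE ltW//.
  have : forall i, `|y i - x i| < e / l.+1%:R by near: x.
  by move=> /(_ i); rewrite ffunE.
rewrite (le_lt_trans H1)// sumr_const card_ord -[ltLHS]mulr_natr mulrAC.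
by rewrite ltr_pdivrMr ?ltr0n// ltr_pM2l// ltr_nat.
Unshelve. all: by end_near. Qed.

HB.instance Definition _ := Uniform_isComplete.Build (tensC H l) tensC_complete.

HB.instance Definition _ :=
  CompleteNormedModule_isHilbert.Build R (tensC H l) tdot_norm.

(* x \otimes u *)
Definition elemt (x : H) (u : 'cV[R[i]]_l) : tensC H l :=
  [ffun i => u i 0 *: x].

Lemma dot_elemt x y u v :
  hdot (elemt x u) (elemt y v) = hdot x y * \sum_i u i 0 * (v i 0)^*.
Proof.
rewrite [LHS]/(tdot _ _) /tdot mulr_sumr; apply: eq_bigr => i _.
by rewrite !ffunE linearZl_LR linearZr_LR /= mulrA mulrC.
Qed.

Lemma elemt_span (x : tensC H l) : x = \sum_i elemt (x i) (delta_mx i 0).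
Proof.
apply/ffunP => j; rewrite sum_ffunE (bigD1 j)//= big1 => [|i ij].
  by rewrite ffunE mxE !eqxx scale1r addr0.
by rewrite ffunE mxE eq_sym (negPf ij) scale0r.
Qed.

End TensC.

Section BoundedOperators.
Variables (K : numFieldType) (V : normedModType K).

Record bop := Bop {
  bop_fun :> V -> V ;
  bop_linear : linear bop_fun ;
  bop_bounded : exists M : K, forall x, `|bop_fun x| <= M * `|x|
}.

HB.instance Definition _ (T : bop) :=
  GRing.isLinear.Build K V V _ (bop_fun T) (@bop_linear T).

Lemma bopP (S T : bop) : S =1 T -> S = T.
Proof.
case: S T => [f fl fb] [g gl gb] /= /funext fg; subst g.
by rewrite (Prop_irrelevance fl gl) (Prop_irrelevance fb gb).
Qed.

Lemma bop_bound (T : bop) :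
  exists2 M : K, 0 <= M & forall x, `|T x| <= M * `|x|.
Proof.
have [M TM] := bop_bounded T; exists `|M| => // x.
have Mx : 0 <= M * `|x| by rewrite (le_trans _ (TM x)).
by rewrite (le_trans (TM x))// -[leLHS]ger0_norm// normrM normr_id.
Qed.

Lemma bop_continuous (T : bop) : continuous T.
Proof.
apply: bounded_linear_continuous; apply/bounded_funP => r.
have [M M0 TM] := bop_bound T; exists (M * r) => x xr.
by rewrite (le_trans (TM x))// ler_wpM2l.
Qed.

Lemma continuous_bop_bounded (f : {linear V -> V}) : continuous f ->
  exists M : K, forall x, `|f x| <= M * `|x|.
Proof.
move=> /linear_bounded_continuous/linear_boundedP/pinfty_ex_gt0[M _ fM].
by exists M.
Qed.

Let zero_linear : linear ((fun=> 0) : V -> V).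
Proof. by move=> a x y; rewrite scaler0 addr0. Qed.

Let zero_bounded : exists M : K, forall x : V, `|0 : V| <= M * `|x|.
Proof. by exists 0 => x; rewrite normr0 mul0r. Qed.

Let one_linear : linear (id : V -> V).
Proof. by []. Qed.

Let one_bounded : exists M : K, forall x : V, `|id x| <= M * `|x|.
Proof. by exists 1 => x; rewrite mul1r. Qed.

Let add_linear (S T : bop) : linear ((fun x => S x + T x) : V -> V).
Proof. by move=> a x y; rewrite !linearP scalerDr addrACA. Qed.

Let add_bounded (S T : bop) :
  exists M : K, forall x, `|S x + T x| <= M * `|x|.
Proof.
have [[M SM] [N TN]] := (bop_bounded S, bop_bounded T).
by exists (M + N) => x; rewrite mulrDl (le_trans (ler_normD _ _))// lerD.
Qed.

Let scale_linear (a : K) (T : bop) : linear ((fun x => a *: T x) : V -> V).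
Proof. by move=> c x y; rewrite linearP scalerDr !scalerA mulrC. Qed.

Let scale_bounded (a : K) (T : bop) :
  exists M : K, forall x, `|a *: T x| <= M * `|x|.
Proof.
have [M TM] := bop_bounded T.
by exists (`|a| * M) => x; rewrite normrZ -mulrA ler_wpM2l.
Qed.

Let mul_linear (S T : bop) : linear ((fun x => S (T x)) : V -> V).
Proof. by move=> a x y; rewrite !linearP. Qed.

Let mul_bounded (S T : bop) : exists M : K, forall x, `|S (T x)| <= M * `|x|.
Proof.
have [[M M0 SM] [N N0 TN]] := (bop_bound S, bop_bound T).
by exists (M * N) => x; rewrite (le_trans (SM _))// -mulrA ler_wpM2l.
Qed.

Definition bop_zero := Bop zero_linear zero_bounded.
Definition bop_one := Bop one_linear one_bounded.
Definition bop_add S T := Bop (add_linear S T) (add_bounded S T).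
Definition bop_scale a T := Bop (scale_linear a T) (scale_bounded a T).
Definition bop_mul S T := Bop (mul_linear S T) (mul_bounded S T).

HB.instance Definition _ := gen_eqMixin bop.
HB.instance Definition _ := gen_choiceMixin bop.

Let bop_addA : associative bop_add.
Proof. by move=> *; apply: bopP => x /=; rewrite addrA. Qed.
Let bop_addC : commutative bop_add.
Proof. by move=> *; apply: bopP => x /=; rewrite addrC. Qed.
Let bop_add0 : left_id bop_zero bop_add.
Proof. by move=> *; apply: bopP => x /=; rewrite add0r. Qed.
Let bop_addN : left_inverse bop_zero (bop_scale (-1)) bop_add.
Proof. by move=> *; apply: bopP => x /=; rewrite scaleN1r addNr. Qed.

HB.instance Definition _ :=
  GRing.isZmodule.Build bop bop_addA bop_addC bop_add0 bop_addN.

Let bop_mulA : associative bop_mul.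
Proof. by move=> *; apply: bopP. Qed.
Let bop_mul1l : left_id bop_one bop_mul.
Proof. by move=> *; apply: bopP. Qed.
Let bop_mul1r : right_id bop_one bop_mul.
Proof. by move=> *; apply: bopP. Qed.
Let bop_mulDl : left_distributive bop_mul bop_add.
Proof. by move=> *; apply: bopP. Qed.
Let bop_mulDr : right_distributive bop_mul bop_add.
Proof. by move=> *; apply: bopP => x /=; rewrite linearD. Qed.

(* The ring is trivial when V = 0, hence neither a unitRingType nor an
   algType. *)
HB.instance Definition _ := GRing.Zmodule_isPzRing.Build bop
  bop_mulA bop_mul1l bop_mul1r bop_mulDl bop_mulDr.

Let bop_scaleA a c T : bop_scale a (bop_scale c T) = bop_scale (a * c) T.
Proof. by apply: bopP => x /=; rewrite scalerA. Qed.
Let bop_scale1 : left_id 1 bop_scale.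
Proof. by move=> T; apply: bopP => x /=; rewrite scale1r. Qed.
Let bop_scaleDr : right_distributive bop_scale +%R.
Proof. by move=> a S T; apply: bopP => x /=; rewrite scalerDr. Qed.
Let bop_scaleDl T : {morph bop_scale^~ T : a c / a + c}.
Proof. by move=> a c; apply: bopP => x /=; rewrite scalerDl. Qed.

HB.instance Definition _ := GRing.Zmodule_isLmodule.Build K bop
  bop_scaleA bop_scale1 bop_scaleDr bop_scaleDl.

Lemma bop0E x : (0 : bop) x = 0. Proof. by []. Qed.
Lemma bop1E x : (1 : bop) x = x. Proof. by []. Qed.
Lemma bopDE (S T : bop) x : (S + T) x = S x + T x. Proof. by []. Qed.
Lemma bopNE (T : bop) x : (- T) x = - T x. Proof. exact: scaleN1r. Qed.
Lemma bopZE a (T : bop) x : (a *: T) x = a *: T x. Proof. by []. Qed.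
Lemma bopME (S T : bop) x : (S * T) x = S (T x). Proof. by []. Qed.

(* Not z%:A, which requires a lalgType. *)
Definition scal (z : K) : bop := z *: (1 : bop).

Definition is_binv (T S : bop) := S * T = 1 /\ T * S = 1.

Definition spectrum (T : bop) : set K :=
  [set z | ~ exists S, is_binv (T - scal z) S].

(* 0 when T is not invertible in the algebra of bounded operators *)
Definition binv (T : bop) : bop := xget 0 [set S | is_binv T S].

Lemma binvP (T : bop) : (exists S, is_binv T S) -> is_binv T (binv T).
Proof. by move=> [S TS]; rewrite /binv; case: xgetP => [//|/(_ S)]. Qed.

End BoundedOperators.

Section TensorOperators.
Variables (R : realType) (H : hilbertType R) (l : nat).

Definition tens_fun (T : bop H) (A : 'M[R[i]]_l) (x : tensC H l) : tensC H l :=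
  [ffun i => \sum_j A i j *: T (x j)].

Let tens_linear T A : linear (tens_fun T A).
Proof.
move=> a x y; apply/ffunP => i; rewrite !ffunE scaler_sumr -big_split /=.
apply: eq_bigr => j _.
by rewrite !ffunE linearP scalerDr !scalerA [A i j * a]mulrC.
Qed.

Let tens_bounded T A :
  exists M : R[i], forall x, `|tens_fun T A x| <= M * `|x|.
Proof.
have [M M0 TM] := bop_bound T.
exists (\sum_i \sum_j `|A i j| * M) => x.
rewrite (le_trans (tnorm_le_sum _))// mulr_suml ler_sum// => i _.
rewrite ffunE mulr_suml (le_trans (ler_norm_sum _ _ _))// ler_sum// => j _.
rewrite normrZ -mulrA ler_wpM2l// (le_trans (TM _))// ler_wpM2l//.
exact: le_coord_tnorm.
Qed.

(* T \otimes A, with A acting on column vectors; see [tens_elemt]. *)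
Definition tens T A : bop (tensC H l) :=
  Bop (@tens_linear T A) (@tens_bounded T A).

Lemma tens_elemt T A x u : tens T A (elemt x u) = elemt (T x) (A *m u).
Proof.
apply/ffunP => i; rewrite !ffunE mxE scaler_suml; apply: eq_bigr => j _.
by rewrite ffunE linearZ scalerA.
Qed.

Variables (star : 'I_l -> 'I_l) (b : 'I_l -> bop H).

Definition opB : bop (tensC H l) :=
  \sum_(p : 'I_l * 'I_l | p.2 != star p.1) tens (b p.2) (delta_mx p.1 p.2).

Definition opBt : bop (tensC H l) :=
  \sum_(p : 'I_l * 'I_l | p.2 != star p.1) tens (b p.1) (delta_mx p.1 p.2).

Definition resolvent_b (lambda : R[i]) (i : 'I_l) : bop H :=
  binv (scal H (lambda ^+ 2) - b (star i) * b i).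

Definition b_lambda lambda i : bop H := lambda *: (b i * resolvent_b lambda i).

Definition b0_lambda lambda : bop H :=
  - 1 - \sum_i b i * resolvent_b lambda i * b (star i).

Definition opA lambda : bop H := b0_lambda lambda + \sum_i b_lambda lambda i.

End TensorOperators.

(* Main.v *)
(** B - lambda has the form U V - D, where V sums the coordinates of
    H \otimes C^l into H (after applying the b_j), U copies H back into all
    coordinates, and D = lambda + P with P mixing only the coordinates i and
    i^*.  The square of P is diagonal with entries b_{i^*} b_i, so the
    hypothesis on lambda makes lambda^2 - P^2 = D (lambda - P) invertible.
    Hence U V - D is invertible on H \otimes C^l iff V D^-1 U - 1 is invertible
    on H, and the latter operator is A^(lambda).  For the other operator the
    b_i are moved from V to U. *)
Require Import Defs.
From HB Require Import structures.
From mathcomp Require Import all_boot all_order all_algebra.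
From mathcomp Require Import complex.
From mathcomp Require Import all_classical all_reals all_analysis.

Set Implicit Arguments.
Unset Strict Implicit.
Unset Printing Implicit Defensive.
Import Order.TTheory GRing.Theory Num.Theory.
Import numFieldNormedType.Exports.

Local Open Scope classical_set_scope.
Local Open Scope ring_scope.

Section BoundedOperators.
Variables (K : numFieldType) (V : normedModType K).
Implicit Types (S T : bop V) (a : K).

Lemma bop_sumE (I : Type) (r : seq I) (P : pred I) (F : I -> bop V) x :
  (\sum_(i <- r | P i) F i) x = \sum_(i <- r | P i) F i x.
Proof. by elim/big_rec2: _ => // i y S _ <-. Qed.

Lemma bop_scaleAl a S T : a *: (S * T) = a *: S * T.
Proof. exact: bopP. Qed.

Lemma bop_scaleAr a S T : a *: (S * T) = S * (a *: T).
Proof. by apply: bopP => x /=; rewrite linearZ. Qed.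

Lemma is_binv_cancel T S : is_binv T S <-> cancel T S /\ cancel S T.
Proof.
split=> [[ST TS]|[TK SK]]; last by split; apply: bopP.
by split=> x; rewrite -bopME ?ST ?TS.
Qed.

Lemma is_binvN T S : is_binv T S -> is_binv (- T) (- S).
Proof. by move=> [ST TS]; split; rewrite mulrNN. Qed.

(** The inverses built below are composites passing through a second space; continuity makes such a
    linear map a [bop]. *)
Lemma linear_cancel_binv T (S : {linear V -> V}) :
  continuous S -> cancel T S -> cancel S T -> exists S', is_binv T S'.
Proof.
move=> cS TK SK.
by exists (Bop (@linearP _ _ _ _ S) (continuous_bop_bounded cS)); apply/is_binv_cancel.
Qed.

Lemma spectrum_resolvent T a : ~ spectrum T a ->
  is_binv (scal V a - T) (binv (scal V a - T)).
Proof.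
move=> /contrapT[S TS]; apply: binvP; exists (- S).
by rewrite -opprB; apply: is_binvN.
Qed.

(** Multiply T (a - S T) = (a - T S) T by Q on the left and by P on the right. *)
Lemma resolvent_comm S T a (P Q : bop V) :
  is_binv (scal V a - S * T) P -> is_binv (scal V a - T * S) Q -> T * P = Q * T.
Proof.
move=> [_ P1] [Q1 _].
rewrite -[T * P]mul1r -Q1 -!mulrA; congr (Q * _).
rewrite mulrA -[RHS]mulr1 -P1 mulrA; congr (_ * P).
by rewrite mulrBl mulrBr /scal -bop_scaleAl -bop_scaleAr mul1r mulr1 mulrA.
Qed.

End BoundedOperators.

(** [T] and [C] are, up to sign, the two Schur complements of one block operator. With T = U L - D
    and C = L E U - 1, where E = D^-1, the inverses are C^-1 = L T^-1 U - 1 and T^-1 = E (U C^-1 L E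
    - 1). Both rest on the intertwinings U C = T E U and L E T = C L. *)
Lemma schur_binv (K : numFieldType) (V W : normedModType K) (T D E : bop V)
    (C : bop W) (U : {linear W -> V}) (L : {linear V -> W}) :
  continuous U -> continuous L -> is_binv D E ->
  (forall x, T x = U (L x) - D x) -> (forall s, C s = L (E (U s)) - s) ->
  (exists S, is_binv T S) <-> (exists S, is_binv C S).
Proof.
move=> cU cL /is_binv_cancel[DK EK] TE CE.
split=> -[S /is_binv_cancel[SK KS]].
- apply: (@linear_cancel_binv _ _ _ ((L \o (S \o U)) \- idfun)) => [s|s|t] /=.
  + apply: continuousB; last exact: cvg_id.
    apply: continuous_comp; last exact: cL.
    apply: continuous_comp; last exact: bop_continuous.
    exact: cU.
  + have -> : U (C s) = T (E (U s)) by rewrite TE EK CE linearB.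
    by rewrite SK CE opprB addrC subrK.
  + have US : U (L (S (U t)) - t) = D (S (U t)).
      by rewrite linearB /= -{2}(KS (U t)) TE opprB addrC subrK.
    by rewrite CE US DK opprB addrC subrK.
- apply: (@linear_cancel_binv _ _ _ (E \o ((U \o (S \o (L \o E))) \- idfun))) => [x|x|y] /=.
  + apply: continuous_comp; last exact: bop_continuous.
    apply: continuousB; last exact: cvg_id.
    apply: continuous_comp; last exact: cU.
    apply: continuous_comp; last exact: bop_continuous.
    apply: continuous_comp; last exact: cL.
    exact: bop_continuous.
  + have -> : L (E (T x)) = C (L x) by rewrite TE CE !linearB /= DK.
    by rewrite SK TE opprB addrC subrK DK.
  + rewrite TE EK opprB addrCA.
    set c := S _.
    have -> : L (E (U c - y)) = c.
      rewrite !linearB /=; apply/eqP; rewrite subr_eq addrC -subr_eq -CE.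
      by rewrite KS.
    by rewrite subrr addr0.
Qed.

Section RankOneTensor.
Variables (R : realType) (H : hilbertType R) (l : nat).
Implicit Types c d : 'I_l -> bop H.

Lemma tens_deltaE (T : bop H) i j (x : tensC H l) k :
  tens T (delta_mx i j) x k = if k == i then T (x j) else 0.
Proof.
rewrite ffunE; have [->|ki] := eqVneq k i.
  rewrite (bigD1 j)//= big1 => [|m mj]; first by rewrite mxE !eqxx scale1r addr0.
  by rewrite mxE eqxx (negPf mj) scale0r.
by rewrite big1 // => m _; rewrite mxE (negPf ki) scale0r.
Qed.

Lemma sum_tens_deltaE (P : pred ('I_l * 'I_l)) (T : 'I_l * 'I_l -> bop H)
    (x : tensC H l) k :
  (\sum_(p | P p) tens (T p) (delta_mx p.1 p.2)) x k
  = \sum_(j | P (k, j)) T (k, j) (x j).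
Proof.
rewrite bop_sumE sum_ffunE.
under eq_bigr do rewrite tens_deltaE.
rewrite (eq_big (fun p => P (p.1, p.2))
  (fun p => if k == p.1 then T (p.1, p.2) (x p.2) else 0)); [|by case|by case].
rewrite -(pair_big_dep xpredT (fun i j => P (i, j))
  (fun i j => if k == i then T (i, j) (x j) else 0)) /=.
rewrite (bigD1 k)//= [X in _ + X]big1 => [|i ik].
  by rewrite addr0; apply: eq_bigr => j _; rewrite eqxx.
by apply: big1 => j _; rewrite eq_sym (negPf ik).
Qed.

Lemma tensC_addE (x y : tensC H l) i : (x + y) i = x i + y i.
Proof. exact: ffunE. Qed.

Lemma tensC_oppE (x : tensC H l) i : (- x) i = - x i.
Proof. exact: ffunE. Qed.

Lemma tensC_scaleE a (x : tensC H l) i : (a *: x) i = a *: x i.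
Proof. exact: ffunE. Qed.

(** The composite [tens_col c \o tens_row d] is the block operator with (i, j) entry c_i d_j: a
    rank-one pattern factoring through [H]. *)
Definition tens_col c (h : H) : tensC H l := [ffun i => c i h].
Definition tens_row d (x : tensC H l) : H := \sum_i d i (x i).

Fact tens_col_linear c : linear (tens_col c).
Proof. by move=> a x y; apply/ffunP => i; rewrite !ffunE linearP. Qed.

Fact tens_row_linear d : linear (tens_row d).
Proof.
move=> a x y; rewrite /tens_row scaler_sumr -big_split; apply: eq_bigr => i _.
by rewrite !ffunE linearP.
Qed.

HB.instance Definition _ c :=
  GRing.isLinear.Build R[i] H (tensC H l) _ (tens_col c) (@tens_col_linear c).
HB.instance Definition _ d :=
  GRing.isLinear.Build R[i] (tensC H l) H _ (tens_row d) (@tens_row_linear d).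


Lemma tens_col_continuous c : continuous (tens_col c).
Proof.
apply: bounded_linear_continuous; apply/bounded_funP => r.
pose M i := projT1 (cid2 (bop_bound (c i))).
exists (\sum_i M i * r) => x xr; rewrite (le_trans (tnorm_le_sum _))//.
apply: ler_sum => i _; rewrite ffunE /M; case: cid2 => /= m m0 cm.
by rewrite (le_trans (cm _))// ler_wpM2l.
Qed.

Lemma tens_row_continuous d : continuous (tens_row d).
Proof.
apply: bounded_linear_continuous; apply/bounded_funP => r.
pose M i := projT1 (cid2 (bop_bound (d i))).
exists (\sum_i M i * r) => x xr; rewrite (le_trans (ler_norm_sum _ _ _))//.
apply: ler_sum => i _; rewrite /M; case: cid2 => /= m m0 dm.
rewrite (le_trans (dm _))// ler_wpM2l// (le_trans _ xr)//.
exact: le_coord_tnorm.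
Qed.


Variables (star : 'I_l -> 'I_l) (starK : involutive star).

(** This treats both operators at once: c = 1, d = b gives [opB], and c = b, d = 1 gives [opBt]. *)
Lemma spectrum_row_col c d (lambda : R[i]) (r : 'I_l -> bop H) :
  (forall i, is_binv
     (scal H (lambda ^+ 2) - c i * d (star i) * (c (star i) * d i)) (r i)) ->
  spectrum (\sum_(p : 'I_l * 'I_l | p.2 != star p.1)
    tens (c p.1 * d p.2) (delta_mx p.1 p.2)) lambda <->
  spectrum (\sum_i (lambda *: (d i * r i * c i)
    - d i * c i * d (star i) * r (star i) * c (star i)) - 1) 0.
Proof.
move=> rP.
(* [P] collects the entries j = i^* excluded from the sum, and [Q] will be the inverse of lambda^2 -
   P^2. *)
pose P : bop (tensC H l) := \sum_(p : 'I_l * 'I_l | p.2 == star p.1)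
  tens (c p.1 * d p.2) (delta_mx p.1 p.2).
pose Q : bop (tensC H l) := \sum_(p : 'I_l * 'I_l | p.2 == p.1)
  tens (r p.1) (delta_mx p.1 p.2).
pose sl := scal (tensC H l) lambda.
have PE x i : P x i = c i (d (star i) (x (star i))).
  by rewrite sum_tens_deltaE /= big_pred1_eq.
have QE x i : Q x i = r i (x i) by rewrite sum_tens_deltaE /= big_pred1_eq.
(* Applying [P] twice returns to coordinate i, so P^2 is diagonal with entries c_i d_{i^*} c_{i^*}
   d_i. *)
have [QK KQ] : is_binv (scal _ (lambda ^+ 2) - P * P) Q.
  apply/is_binv_cancel; split=> x; apply/ffunP => i;
    have /is_binv_cancel[rK Kr] := rP i.
    rewrite QE -[RHS]rK !bopDE !bopNE tensC_addE tensC_oppE !bopME !PE starK.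
    by rewrite !bopZE tensC_scaleE.
  rewrite -[RHS]Kr !bopDE !bopNE tensC_addE tensC_oppE !bopME !PE starK.
  by rewrite !bopZE tensC_scaleE !QE.
have slP : sl * P = P * sl by rewrite -bop_scaleAl -bop_scaleAr mul1r mulr1.
have sl2 : sl * sl = scal _ (lambda ^+ 2) by rewrite -bop_scaleAl mul1r scalerA.
have comm1 : (sl + P) * (sl - P) = scal _ (lambda ^+ 2) - P * P.
  by rewrite mulrDl !mulrBr slP sl2 addrA subrK.
have comm2 : (sl - P) * (sl + P) = scal _ (lambda ^+ 2) - P * P.
  by rewrite mulrBl !mulrDr slP sl2 opprD addrA addrK.
(* [Q] gives a right inverse (sl - P) Q and a left inverse Q (sl - P) of sl + P; these must
   coincide. *)
have DE : is_binv (sl + P) ((sl - P) * Q).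
  have right_inv : (sl + P) * ((sl - P) * Q) = 1 by rewrite mulrA comm1.
  have left_inv : Q * (sl - P) * (sl + P) = 1 by rewrite -mulrA comm2.
  have QC : Q * (sl - P) = (sl - P) * Q.
    by rewrite -[LHS]mulr1 -right_inv mulrA left_inv mul1r.
  by split=> //; rewrite -QC.
have TE x : (\sum_(p : 'I_l * 'I_l | p.2 != star p.1)
      tens (c p.1 * d p.2) (delta_mx p.1 p.2) - sl) x
    = tens_col c (tens_row d x) - (sl + P) x.
  apply/ffunP => i.
  rewrite !(bopDE, bopNE, tensC_addE, tensC_oppE, bopZE, tensC_scaleE, bop1E).
  rewrite sum_tens_deltaE PE ffunE /tens_row linear_sum /= opprD addrCA.
  (* The term j = i^* of the full row sum cancels the contribution of [P]. *)
  rewrite [X in _ = _ + (X - _)](bigD1 (star i))//= addrAC subrr add0r addrC.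
  by [].
have CE s : (\sum_i (lambda *: (d i * r i * c i)
      - d i * c i * d (star i) * r (star i) * c (star i)) - 1 - scal H 0) s
    = tens_row d (((sl - P) * Q) (tens_col c s)) - s.
  rewrite /scal scale0r subr0 bopDE bopNE bop1E bop_sumE.
  congr (_ - _); apply: eq_bigr => i _.
  rewrite !(bopDE, bopNE, bopME, bopZE, bop1E, tensC_addE, tensC_oppE).
  by rewrite tensC_scaleE PE !QE !ffunE linearB linearZ.
have := schur_binv (@tens_col_continuous c) (@tens_row_continuous d) DE TE CE.
by move=> [TC CT]; split; apply: contra_not.
Qed.

End RankOneTensor.

Theorem proposition17 (R : realType) (H : hilbertType R) (l : nat)
    (l_gt0 : (1 <= l)%N) (star : 'I_l -> 'I_l) (starK : involutive star)
    (b : 'I_l -> bop H) (lambda : R[i])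
    (hlambda : forall i, ~ spectrum (b i * b (star i)) (lambda ^+ 2)) :
  (spectrum (opB star b) lambda <-> spectrum (opA star b lambda) 0) /\
  (spectrum (opBt star b) lambda <-> spectrum (opA star b lambda) 0).
Proof.
pose r := resolvent_b star b lambda.
have rP i : is_binv (scal H (lambda ^+ 2) - b (star i) * b i) (r i).
  (* The hypothesis is used at i^*, since the resolvent involves b_{i^*} b_i rather than b_i
     b_{i^*}. *)
  by apply: spectrum_resolvent; have := hlambda (star i); rewrite starK.
have rPs i : is_binv (scal H (lambda ^+ 2) - b i * b (star i)) (r (star i)).
  by have := rP (star i); rewrite starK.
have brC i : b (star i) * r (star i) = r i * b (star i).
  exact: resolvent_comm (rPs i) (rP i).
have rbC i : b i * r i = r (star i) * b i.
  exact: resolvent_comm (rP i) (rPs i).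
have AE : opA star b lambda = \sum_i (lambda *: (b i * r i)
    - b i * r i * b (star i)) - 1.
  rewrite /opA /b0_lambda /b_lambda sumrB.
  by rewrite addrC addrA addrAC.
split.
- have -> : opB star b = \sum_(p : 'I_l * 'I_l | p.2 != star p.1)
      tens (1 * b p.2) (delta_mx p.1 p.2).
    by apply: eq_bigr => p _; rewrite mul1r.
  rewrite (spectrum_row_col (c := fun=> 1) starK (r := r)) => [|i]; last first.
    by rewrite !mul1r.
  (* The general formula yields b_i b_{i^*} r_{i^*}; [brC] turns it into b_i r_i b_{i^*}. *)
  rewrite AE; under eq_bigr do rewrite !mulr1 -mulrA brC mulrA.
  by [].
- have -> : opBt star b = \sum_(p : 'I_l * 'I_l | p.2 != star p.1)
      tens (b p.1 * 1) (delta_mx p.1 p.2).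
    by apply: eq_bigr => p _; rewrite mulr1.
  (* The diagonal entries of P^2 are now b_i b_{i^*}, so the resolvents are those of index i^*. *)
  rewrite (spectrum_row_col (d := fun=> 1) starK (r := r \o star)) => [|i]; last first.
    by rewrite !mulr1; exact: rPs.
  (* The second terms agree already; [rbC] identifies r_{i^*} b_i with b_i r_i in the first. *)
  rewrite AE; under eq_bigr do rewrite !mul1r mulr1 /= starK -rbC.
  by [].
Qed.
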